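(* Let $(N,v)$ be a cooperative game and let $\mathcal{Q} \subseteq \mathcal{N}$ be an independent collection of coalitions, with $\{h^S \mid S \in \mathcal{Q}\}$ the dual basis of $\{\eta^S \mid S \in \mathcal{Q}\}$. Then for all $x \in X(v)$, $$\pi_{A_\mathcal{Q}}(x) = x + \sum_{S \in \mathcal{Q}} e_S(x)\, h^S .$$
   Context: $N$ is a finite nonempty set of players, and $\mathcal{N}$ is the set of nonempty subsets of $N$, called coalitions. A game is a pair $(N,v)$ with $v : 2^N \to \mathbb{R}$ and $v(\emptyset)=0$. For $x \in \mathbb{R}^N$ and $S \subseteq N$, $x(S) = \sum_{i\in S} x_i$. $\mathbb{R}^N$ carries the usual scalar product $\langle\cdot,\cdot\rangle$ and Euclidean norm. $X(v) = \{x \in \mathbb{R}^N \mid x(N) = v(N)\}$. For $S \subseteq N$, $\mathbf{1}^S \in \mathbb{R}^N$ is the indicator vector of $S$ and $\eta^S = \mathbf{1}^S - \frac{|S|}{|N|}\mathbf{1}^N$. A collection $\mathcal{Q} \subseteq \mathcal{N}$ is independent if the vectors $\{\eta^S \mid S \in \mathcal{Q}\}$ are linearly independent. In that case the dual basis $\{h^S \mid S \in \mathcal{Q}\}$ is the unique family of vectors in $\mathrm{span}\{\eta^S \mid S \in \mathcal{Q}\}$ such that $\langle \eta^S, h^T\rangle = 1$ if $S=T$ and $0$ otherwise, for all $S,T \in \mathcal{Q}$. $A_\mathcal{Q} = \{x \in X(v) \mid x(S) = v(S) \text{ for all } S \in \mathcal{Q}\}$, which is nonempty when $\mathcal{Q}$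 is independent. The excess of $S$ at $x$ is $e_S(x) = v(S) - x(S)$. For a nonempty closed convex set $K \subseteq \mathbb{R}^N$, $\pi_K(x)$ denotes the unique point of $K$ closest to $x$ in Euclidean norm. *)

(* Defs.v *)
From HB Require Import structures.
From mathcomp Require Import classical_sets reals.
From mathcomp Require Import all_boot all_order all_algebra.

Set Implicit Arguments.
Unset Strict Implicit.
Unset Printing Implicit Defensive.

Import Order.TTheory GRing.Theory Num.Theory.
Local Open Scope ring_scope.

Record game (R : realType) (N : finType) := Game {
  worth :> {set N} -> R;
  worth0 : worth set0 = 0
}.

(* R^N; the regular module R^o provides the R-vector space structure. *)
Notation payoffs R N := {ffun N -> (R : realType)^o}.

Section Definitions.
Variables (R : realType) (N : finType).
Local Notation vec := (payoffs R N).
Implicit Types (v : game R N) (x y p : vec) (S T : {set N}) (Q : {set {set N}}).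
Implicit Types (K : set vec) (h : {set N} -> vec).

Definition payoff x S : R := \sum_(i in S) x i.

Definition inner x y : R := \sum_i x i * y i.

Definition enorm x : R := Num.sqrt (inner x x).

Definition preimputations v : set vec :=
  fun x => payoff x [set: N] = v [set: N].

Definition indic S : vec := [ffun i => (i \in S)%:R].

Definition eta S : vec := indic S - (#|S|%:R / #|N|%:R) *: indic [set: N].

(* [free] is independence of the family indexed by Q: a repeated vector
   counts as a dependency. *)
Definition independent Q : bool := free [seq eta T | T in Q].

(* Only the values of h on Q matter.  For independent Q such an h exists and
   is unique on Q: see dual_basis_exists and dual_basis_unique. *)
Definition dual_basis Q h : Prop :=
  (forall S, S \in Q -> h S \in <<[seq eta T | T in Q]>>%VS) /\
  (forall S T, S \in Q -> T \in Q -> inner (eta S) (h T) = (S == T)%:R).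

Definition affineA v Q : set vec :=
  fun x => preimputations v x /\ forall S, S \in Q -> payoff x S = v S.

Definition excess v S x : R := v S - payoff x S.

Definition closest K x p : Prop :=
  K p /\ forall y, K y -> enorm (x - p) <= enorm (x - y).

(* "pi_K(x) = p", as a relation: it asserts that the closest point exists,
   is unique and is p. *)
Definition is_projection K x p : Prop := unique (closest K x) p.

End Definitions.

Section DualBasis.
Variables (R : realType) (N : finType).
Local Notation vec := (payoffs R N).
Implicit Types (x y : vec) (S T : {set N}) (Q : {set {set N}}).
Implicit Types (h : {set N} -> vec).

Lemma innerC x y : inner x y = inner y x.
Proof. by apply: eq_bigr => i _; rewrite mulrC. Qed.

Lemma inner_sumr (I : finType) x (c : I -> R) (F : I -> vec) :
  inner x (\sum_i c i *: F i) = \sum_i c i * inner x (F i).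
Proof.
rewrite /inner; under eq_bigr => j _ do rewrite sum_ffunE mulr_sumr.
rewrite exchange_big; apply: eq_bigr => i _ /=.
by rewrite mulr_sumr; apply: eq_bigr => j _; rewrite ffunE mulrCA.
Qed.

Lemma innerB x y1 y2 : inner x (y1 - y2) = inner x y1 - inner x y2.
Proof. by rewrite -sumrB; apply: eq_bigr => i _; rewrite !ffunE mulrBr. Qed.

Lemma inner_eq0 x : inner x x = 0 -> x = 0.
Proof.
move=> /eqP; rewrite psumr_eq0 => [|i _]; last by rewrite -expr2 sqr_ge0.
move=> /allP x0; apply/ffunP => i; apply/eqP; rewrite ffunE.
by have := x0 i (mem_index_enum _); rewrite /= mulf_eq0 orbb.
Qed.

Definition etas Q : #|Q|.-tuple vec := [tuple eta R (enum_val i) | i < #|Q|].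

Lemma etasE Q : etas Q = [seq eta R T | T in Q] :> seq vec.
Proof.
apply: (@eq_from_nth _ 0) => [|k]; rewrite size_tuple ?size_image // => kQ.
rewrite -[k]/(val (Ordinal kQ)) -tnth_nth tnth_mktuple.
by rewrite (nth_map set0) -?cardE // (enum_val_nth set0).
Qed.

Lemma etas_nth Q (i : 'I_#|Q|) : (etas Q)`_i = eta R (enum_val i).
Proof. by rewrite -tnth_nth tnth_mktuple. Qed.

Lemma dual_basis_exists Q : independent R Q ->
  exists h : {set N} -> vec, dual_basis Q h.
Proof.
rewrite /independent -etasE => /freeP freeQ.
pose X (i : 'I_#|Q|) : vec := eta R (enum_val i).
pose G : 'M[R]_#|Q| := \matrix_(i, j) inner (X i) (X j).
have Gunit : G \in unitmx.
  rewrite -row_free_unit -kermx_eq0; apply/rowV0P => u /sub_kermxP uG.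
  apply/rowP => i; rewrite mxE; apply: (freeQ (fun i => u 0 i)).
  under eq_bigr => k _ do rewrite etas_nth -/(X k).
  apply: inner_eq0; rewrite inner_sumr big1 // => j _.
  rewrite innerC inner_sumr; have := congr1 (fun A : 'rV_#|Q| => A 0 j) uG.
  rewrite !mxE => /= uGj; rewrite -[RHS](mulr0 (u 0 j)); congr (_ * _).
  by rewrite -[RHS]uGj; apply: eq_bigr => k _; rewrite mxE innerC.
pose H (j : 'I_#|Q|) : vec := \sum_i invmx G i j *: X i.
exists (fun S => if insub (index S (enum Q)) is Some j then H j else 0).
have idx S : S \in Q -> exists2 j : 'I_#|Q|,
    insub (index S (enum Q)) = Some j & enum_val j = S.
  move=> SQ; have lt : (index S (enum Q) < #|Q|)%N.
    by rewrite cardE index_mem mem_enum.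
  by exists (Ordinal lt); rewrite ?insubT // (enum_val_nth set0) nth_index ?mem_enum.
split=> [S /idx[j -> _]|S T /idx[i _ <-] /idx[j -> <-]].
  apply: memv_suml => i _; apply: memvZ; apply: memv_span.
  by apply: map_f; rewrite mem_enum enum_valP.
rewrite inner_sumr (inj_eq enum_val_inj).
have := congr1 (fun A : 'M_#|Q| => A i j) (mulmxV Gunit).
by rewrite !mxE => <-; apply: eq_bigr => k _; rewrite mxE mulrC.
Qed.

Lemma dual_basis_unique Q h1 h2 : dual_basis Q h1 -> dual_basis Q h2 ->
  {in Q, h1 =1 h2}.
Proof.
move=> [s1 d1] [s2 d2] S SQ; apply/eqP; rewrite -subr_eq0; apply/eqP.
have: h1 S - h2 S \in <<etas Q>>%VS by rewrite etasE memvB ?s1 ?s2.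
move=> /coord_span; set c := coord _ => hE; apply: inner_eq0.
rewrite {2}hE inner_sumr big1 // => i _; rewrite etas_nth innerC.
suff -> : inner (eta R (enum_val i)) (h1 S - h2 S) = 0 by rewrite mulr0.
by rewrite innerB d1 ?d2 ?enum_valP // subrr.
Qed.

End DualBasis.

(* Main.v *)
Require Import Defs.
From mathcomp Require Import classical_sets reals.
From mathcomp Require Import all_boot all_order all_algebra.

(** The displacement [d := \sum_(S in Q) excess v S x *: h S] lies in the span
    of the vectors [eta S], [S \in Q], because each [h S] does.

    Every [eta S] is orthogonal to the all-ones vector, hence so is [d]: adding
    [d] to [x] keeps the total payoff.  On vectors of total payoff 0, pairing
    with [eta S] is the payoff of [S], so duality says that [d] raises the
    payoff of each [S \in Q] by exactly [excess v S x]; thus [x + d] belongs to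
    [affineA v Q].

    If [y] is another point of [affineA v Q], then [x + d - y] pays 0 to the
    grand coalition and to every [S \in Q].  It is therefore orthogonal to every
    [eta S], hence to [d].  Pythagoras' theorem gives
    [|x - y|^2 = |d|^2 + |x + d - y|^2], so that [x + d] is a closest point and
    the only one. *)

Import Order.TTheory GRing.Theory Num.Theory.
Local Open Scope ring_scope.

Section Projection.
Variables (R : realType) (N : finType).
Local Notation vec := (payoffs R N).
Implicit Types (x y z p : vec) (S : {set N}) (K : set vec).

Lemma inner_span_eq0 (X : seq vec) x y :
  (forall z, z \in X -> inner x z = 0) -> y \in <<X>>%VS -> inner x y = 0.
Proof.
move=> orthX /(@coord_span _ _ _ (in_tuple X)) ->.
rewrite inner_sumr big1 // => i _.
by rewrite orthX ?mulr0 // mem_nth.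
Qed.

Lemma payoffD x y S : payoff (x + y) S = payoff x S + payoff y S.
Proof. by rewrite -big_split; apply: eq_bigr => i _; rewrite ffunE. Qed.

Lemma payoffB x y S : payoff (x - y) S = payoff x S - payoff y S.
Proof. by rewrite -sumrB; apply: eq_bigr => i _; rewrite !ffunE. Qed.

Lemma inner_indic x S : inner x (indic R S) = payoff x S.
Proof.
rewrite /payoff big_mkcond; apply: eq_bigr => i _.
by rewrite ffunE; case: (i \in S); rewrite ?mulr1 ?mulr0.
Qed.

Lemma inner_ge0 x : 0 <= inner x x.
Proof. by apply: sumr_ge0 => i _; rewrite -expr2 sqr_ge0. Qed.

Lemma innerZ x y (a : R) : inner x (a *: y) = a * inner x y.
Proof. by rewrite mulr_sumr; apply: eq_bigr => i _; rewrite ffunE mulrCA. Qed.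

Lemma inner_eta y S :
  inner y (eta R S) = payoff y S - #|S|%:R / #|N|%:R * payoff y [set: N].
Proof. by rewrite innerB innerZ !inner_indic. Qed.

Lemma payoff_eta S : (0 < #|N|)%N -> payoff (eta R S) [set: N] = 0.
Proof.
move=> N_gt0; rewrite -inner_indic innerC inner_eta.
have payoff1 T : payoff (indic R [set: N]) T = #|T|%:R.
  rewrite /payoff -sum1_card natr_sum.
  by apply: eq_bigr => i _; rewrite ffunE inE.
by rewrite !payoff1 cardsT divfK ?subrr // pnatr_eq0 -lt0n.
Qed.

(** Moving from [x] to [p] and then from [p] to any [y] in [K] turns a right
    angle, so [y] is farther from [x] than [p], strictly unless [y = p]. *)
Lemma orthogonal_projection K x p :
  K p -> (forall y, K y -> inner (p - y) (p - x) = 0) -> is_projection K x p.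
Proof.
move=> Kp orth.
have pythagoras y : K y ->
    inner (x - y) (x - y) = inner (x - p) (x - p) + inner (p - y) (p - y).
  move=> Ky.
  have -> : inner (x - y) (x - y) = inner (x - p) (x - p)
      + inner (p - y) (p - y) - (inner (p - y) (p - x) *+ 2).
    rewrite /inner -mulr_natr mulr_suml -big_split -sumrB /=.
    apply: eq_bigr => i _; rewrite !ffunE.
    rewrite -[x i - y i](subrKA (p i)) -(opprB (x i)) mulrN mulNr opprK.
    by rewrite -!expr2 sqrrD mulr_natr addrAC [_ * (x i - _)]mulrC.
  by rewrite orth // mul0rn subr0.
split=> [|q [Kq q_closest]].
  by split=> // y Ky; rewrite ler_wsqrtr // (pythagoras y) // lerDl inner_ge0.
apply/eqP; rewrite -subr_eq0; apply/eqP/inner_eq0/eqP.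
rewrite eq_le inner_ge0 andbT.
have := q_closest p Kp.
by rewrite ler_sqrt ?inner_ge0 // (pythagoras q) // gerDl.
Qed.

End Projection.

Theorem theorem9 (R : realType) (N : finType) (N_gt0 : (0 < #|N|)%N)
    (v : game R N) (Q : {set {set N}}) (coalQ : forall S, S \in Q -> S != set0)
    (indepQ : independent R Q) (h : {set N} -> payoffs R N)
    (dualh : dual_basis Q h) (x : payoffs R N) (Xx : preimputations v x) :
  is_projection (affineA v Q) x (x + \sum_(S in Q) excess v S x *: h S).
Proof.
case: dualh => h_span h_dual.
set d := \sum_(S in Q) _.
have d_span : d \in <<[seq eta R T | T in Q]>>%VS.
  by apply: memv_suml => S SQ; apply/memvZ/h_span.
have orth_d y : (forall S, S \in Q -> inner y (eta R S) = 0) -> inner y d = 0.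
  move=> orth_eta; apply: inner_span_eq0 d_span => z /imageP[S SQ ->].
  exact: orth_eta.
have dN : payoff d [set: N] = 0.
  rewrite -inner_indic innerC; apply: orth_d => S _.
  by rewrite innerC inner_indic payoff_eta.
have dQ S : S \in Q -> payoff d S = excess v S x.
  move=> SQ; have := inner_eta _ _ d S; rewrite dN mulr0 subr0 => <-.
  rewrite innerC /d big_mkcond /=.
  have -> : \sum_T (if T \in Q then excess v T x *: h T else 0)
      = \sum_T (if T \in Q then excess v T x else 0) *: h T.
    by apply: eq_bigr => T _; case: ifP; rewrite ?scale0r.
  rewrite inner_sumr (bigD1 S) //= SQ h_dual // eqxx mulr1 big1 ?addr0 // => T.
  case: ifP => TQ neTS; last by rewrite mul0r.
  by rewrite h_dual // eq_sym (negPf neTS) mulr0.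
have Ap : affineA v Q (x + d).
  split=> [|S SQ]; first by rewrite /preimputations payoffD dN addr0.
  by rewrite payoffD dQ // addrC subrK.
apply: orthogonal_projection => // y [Xy yQ].
rewrite [x + d - x]addrC addKr; apply: orth_d => S SQ.
case: Ap => Xp pQ.
by rewrite inner_eta !payoffB Xp Xy pQ // yQ // !subrr mulr0 subr0.
Qed.
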